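(* For each of the two passenger responses (Linear and MinImprov): consider an instance of the bi-objective BRT investment problem $\textsc{BRT}(\star/Z\ge1/|M|=1)$ with a single municipality and with equal upgrade costs, i.e. there is a $c$ such that $c_e=c$ for all $e\in E$. Then there are at most $n$ non-dominated points, where $n=|V|$ is the number of stations.
   Context: An instance (with a single municipality, $|M|=1$, whose budget share is $1$) consists of: a linear graph $G=(V,E)$ with $V=\{1,\dots,n\}$, $n\in\mathbb N_{\ge1}$ (stations) and $E=\{e_i=\{i,i+1\}: i\in\{1,\dots,n-1\}\}$ (segments); upgrade costs $c_e\in\mathbb N_{\ge1}$ for $e\in E$; a bound $Z\in\mathbb N_{\ge1}$; a set of OD pairs $D\subseteq\{(i,j):i,j\in V,i\neq j\}$, where $W_d\subseteq E$ denotes the edge set of the unique path from $i$ to $j$ in $G$ for $d=(i,j)\in D$; numbers of potential passengers $a_d\in\mathbb N_{\ge1}$ for $d\in D$; infrastructure improvements $u_e\in\mathbb R_{>0}$ for $e\in E$; and, for MinImprov, thresholds $L_d\in\mathbb R_{\ge0}$ with $L_d\le\sum_{e\in W_d}u_e$ for $d\in D$. For $F\subseteq E$ the number of newly attracted passengers is $p(F)=\sum_{d\in D}p_d(F)$, where in Linear $p_d(F)=a_d\cdot\frac{\sum_{e\in F\cap W_d}u_e}{\sum_{e\in W_d}u_e}$, and in MinImprov $p_d(F)=a_d$ if $L_d\le\sum_{e\in F\cap W_d}u_e$ and $p_d(F)=0$ otherwise. A pair $(F,v)$ with $F\subseteq E$, $v\in\mathbb R_{\ge0}$ is feasible if $\sum_{e\in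 F}c_e\le v$ and the subgraph $G[F]$ consisting of the edges in $F$ and their incident nodes has at most $Z$ connected components. The problem is to maximize $p(F)$ and minimize $v$ over feasible $(F,v)$. The point $(p(F),v)$ of a feasible $(F,v)$ is non-dominated if there is no feasible $(F',v')$ with $p(F')\ge p(F)$, $v'\le v$ and at least one inequality strict. *)

(* Defs.v *)
From mathcomp Require Import all_boot all_order all_algebra.
From mathcomp Require Import all_classical reals.
From mathcomp Require Import zify.

Set Implicit Arguments.
Unset Strict Implicit.
Unset Printing Implicit Defensive.

Import Order.TTheory GRing.Theory Num.Theory.

Local Open Scope ring_scope.

(* The stations 1, ..., n are the elements of ['I_n], shifted to 0, ..., n-1.
   An edge is the two-element set of its endpoints. *)
Definition segments (n : nat) : {set {set 'I_n}} :=
  [set [set x; y] | x in 'I_n, y in [set y : 'I_n | y == x.+1 :> nat]]%SET.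

Definition adj (n : nat) (F : {set {set 'I_n}}) : rel 'I_n :=
  [rel x y | [set x; y]%SET \in F].

(* [x :: p] is a simple path from [x] to [y] in the graph with edge set [F]. *)
Definition simple_path (n : nat) (F : {set {set 'I_n}}) (x y : 'I_n)
    (p : seq 'I_n) : bool :=
  [&& path (adj F) x p, last x p == y & uniq (x :: p)].

Definition path_edges (n : nat) (x : 'I_n) (p : seq 'I_n) : seq {set 'I_n} :=
  pairmap (fun y z => [set y; z]%SET) x p.

(* The edge set of the path from [d.1] to [d.2]; existence and uniqueness of
   that path are [simple_path_exists] and [simple_path_unique], and [WE] states
   that its edge set is [W d]. *)
Definition W (n : nat) (d : 'I_n * 'I_n) : {set {set 'I_n}} :=
  [set e in segments n |
    `[< exists p, simple_path (segments n) d.1 d.2 p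
                  /\ e \in path_edges d.1 p >]]%SET.

Lemma adj_segments n (x y : 'I_n) :
  adj (segments n) x y = (y == x.+1 :> nat) || (x == y.+1 :> nat).
Proof.
rewrite /adj /=; apply/imset2P/orP => [[a b _]|].
  rewrite inE => /eqP ba /setP eqs.
  have [] := (eqs x, eqs y); rewrite !inE !eqxx ?orbT /=.
  have [] := (eqs a, eqs b); rewrite !inE !eqxx ?orbT /=.
  move=> ha hb /esym/orP[]/eqP hx /esym/orP[]/eqP hy; subst x y.
  - by move: hb; rewrite orbb -val_eqE /= ba (gtn_eqF (ltnSn _)).
  - by left; rewrite ba.
  - by right; rewrite ba.
  - by move: ha; rewrite orbb -val_eqE /= ba (ltn_eqF (ltnSn _)).
by case=> /eqP h; [exists x y | exists y x]; rewrite ?inE ?h // finset.setUC.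
Qed.

Lemma path_after n (x y : 'I_n) p : path (adj (segments n)) y p ->
  x \notin y :: p -> (x < y)%N = (x < last y p)%N.
Proof.
elim: p y => //= z p IH y /andP[ayz pz]; rewrite !inE !negb_or.
case/and3P=> xy xz xp; rewrite -IH ?inE ?negb_or ?xz //.
move: ayz xy xz; rewrite adj_segments -!val_eqE /= => /orP[]/eqP-> xy xz.
  by rewrite ltnS [RHS]leq_eqVlt (negPf xy).
by rewrite ltnS leq_eqVlt (negPf xz).
Qed.

Lemma simple_path_unique n (x y : 'I_n) p q :
  simple_path (segments n) x y p -> simple_path (segments n) x y q -> p = q.
Proof.
elim: p x q => [|z p IH] x [|t q] //.
- case/and3P=> _ /eqP /= <- _ /and3P[_ /eqP /= l /andP[+ _]].
  by rewrite -{1}l mem_last.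
- case/and3P=> _ /eqP /= l /andP[+ _] /and3P[_ /eqP /= xy _].
  by rewrite -l in xy; rewrite {1}xy mem_last.
rewrite /simple_path /= => /and3P[/andP[xz pz] /eqP lz /andP[nz uz]].
case/and3P=> [/andP[xt pt] /eqP lt /andP[nt ut]].
have hzt : (x < z)%N = (x < t)%N.
  by rewrite (path_after pz nz) (path_after pt nt) lz lt.
have zt : z = t.
  apply: val_inj => /=; move: hzt xz xt; rewrite !adj_segments.
  by move=> + /orP[]/eqP hz /orP[]/eqP ht; lia.
subst t; congr cons; apply: (IH z).
  by rewrite /simple_path /= pz uz lz eqxx.
by rewrite /simple_path /= pt ut lt eqxx.
Qed.

Lemma simple_path_exists n (x y : 'I_n) :
  exists p, simple_path (segments n) x y p.
Proof.
have cn (a b : 'I_n) k : (b = a + k :> nat)%N ->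
    connect (adj (segments n)) a b && connect (adj (segments n)) b a.
  elim: k b => [|k IH] b hb.
    by rewrite (_ : b = a) ?connect0 //; apply: val_inj; rewrite /= hb addn0.
  have lt : (a + k < n)%N by apply: leq_ltn_trans (ltn_ord b); rewrite hb leq_add2l.
  have /andP[h1 h2] := IH (Ordinal lt) erefl.
  apply/andP; split; [apply: connect_trans h1 _ | apply: connect_trans _ h2];
    by apply: connect1; rewrite adj_segments /= hb addnS eqxx ?orbT.
have : connect (adj (segments n)) x y.
  have [h|/ltnW h] := leqP x y.
    by have /andP[] := cn x y (y - x)%N (esym (subnKC h)).
  by have /andP[] := cn y x (x - y)%N (esym (subnKC h)).
case/connectP => p pp ->; case/shortenP: pp => q pq uq _.
by exists q; rewrite /simple_path pq uq eqxx.
Qed.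

Lemma path_edges_sub n (x : 'I_n) p e : path (adj (segments n)) x p ->
  e \in path_edges x p -> e \in segments n.
Proof.
elim: p x => //= y p IH x /andP[xy py]; rewrite inE => /orP[/eqP->//|].
exact: IH.
Qed.

Lemma WE n (x y : 'I_n) p : simple_path (segments n) x y p ->
  W (x, y) = [set e in path_edges x p]%SET.
Proof.
move=> sp; apply/setP => e; rewrite !inE; apply/andP/idP => [[_ /asboolP[q [sq]]]|he].
  by rewrite (simple_path_unique sp sq).
by split; [apply: path_edges_sub he; case/and3P: sp | apply/asboolP; exists p].
Qed.

(* An instance with a single municipality of budget share 1.  The data are total
   functions, constrained and used only on [segments n] resp. on [OD]. *)
Record instance (R : realType) (n : nat) := Instance {
  cost : {set 'I_n} -> nat;
  cost_ge1 : forall e, e \in segments n -> (1 <= cost e)%N;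
  Z : nat;
  Z_ge1 : (1 <= Z)%N;
  OD : {set 'I_n * 'I_n};
  OD_neq : forall d, d \in OD -> d.1 != d.2;
  pot : 'I_n * 'I_n -> nat;
  pot_ge1 : forall d, d \in OD -> (1 <= pot d)%N;
  impr : {set 'I_n} -> R;
  impr_gt0 : forall e, e \in segments n -> 0 < impr e
}.

Section Problem.
Variables (R : realType) (n : nat) (I : instance R n).
Implicit Types (F : {set {set 'I_n}}) (d : 'I_n * 'I_n).

Definition p_linear F : R :=
  \sum_(d in OD I) (pot I d)%:R *
    ((\sum_(e in F :&: W d) impr I e) / (\sum_(e in W d) impr I e)).

Definition thresholds (L : 'I_n * 'I_n -> R) : Prop :=
  forall d, d \in OD I -> 0 <= L d <= \sum_(e in W d) impr I e.

Definition p_minimprov (L : 'I_n * 'I_n -> R) F : R :=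
  \sum_(d in OD I)
    (if L d <= \sum_(e in F :&: W d) impr I e then (pot I d)%:R else 0).

(* [finset.cover F] is the set of nodes incident to the edges in [F]. *)
Definition feasible F (v : R) : Prop :=
  [/\ F \subset segments n, 0 <= v, (\sum_(e in F) cost I e)%:R <= v
    & (n_comp (adj F) (finset.cover F) <= Z I)%N].

Definition nondominated (p : {set {set 'I_n}} -> R) : set (R * R) :=
  [set z : R * R | exists F v, [/\ feasible F v, z = (p F, v) &
     ~ exists F' v', [/\ feasible F' v', p F <= p F', v' <= v
                       & p F < p F' \/ v' < v]]]%classic.

End Problem.

(* Main.v *)
(* A non-dominated point has v = cost of F = c * #|F|, and two non-dominated
   points with the same v have the same p(F).  Hence a non-dominated point is
   determined by #|F|, which is at most the number n - 1 of segments; neither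
   the passenger response nor the bound Z plays a role. *)
Require Import Defs.
From mathcomp Require Import all_boot all_order all_algebra.
From mathcomp Require Import all_classical reals.

Set Implicit Arguments.
Unset Strict Implicit.
Unset Printing Implicit Defensive.

Import Order.TTheory GRing.Theory Num.Theory.

Local Open Scope ring_scope.

(** A segment is determined by its left endpoint, which is never the last station. *)
Lemma card_segments_lt (n : nat) : (1 <= n)%N -> (#|segments n| < n)%N.
Proof.
case: n => // n _; rewrite ltnS.
(* At [ord_max] the successor is out of range and [inord] gives a junk value; the image is taken
   only over the other stations. *)
pose f (x : 'I_n.+1) := [set x; inord x.+1]%SET.
rewrite -[leqRHS](_ : #|[set~ @ord_max n]%SET| = n); last first.
  by rewrite cardsC1 card_ord.
apply: leq_trans (leq_imset_card f _).
apply/subset_leq_card/fintype.subsetP => e /imset2P[x y _].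
rewrite inE => /eqP yx ->.
apply/imsetP; exists x.
  by rewrite !inE -val_eqE /= neq_ltn -ltnS -yx ltn_ord.
by rewrite /f -yx inord_val.
Qed.

Section Nondominated.
Variables (R : realType) (n : nat) (I : instance R n).
Variable p : {set {set 'I_n}} -> R.

(** Any slack could be removed by lowering [v] to the cost of [F], which keeps feasibility and
    [p F]. *)
Lemma nondominated_cost (z : R * R) : nondominated I p z ->
  exists2 F : {set {set 'I_n}}, F \subset segments n
    & z.2 = (\sum_(e in F) cost I e)%:R.
Proof.
case=> F [v [[sF v0 costF compF] -> nd]]; exists F => //=.
apply/eqP; rewrite eq_le costF andbT leNgt; apply/negP => ltv.
by apply: nd; exists F, (\sum_(e in F) cost I e)%:R; do !split=> //; right.
Qed.

Lemma nondominated_inj (z z' : R * R) :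
  nondominated I p z -> nondominated I p z' -> z.2 = z'.2 -> z = z'.
Proof.
case=> F [v [fF -> nd]] [F' [v' [fF' -> nd']]] /= vv'; subst v'.
congr pair; have [lt|lt|//] := ltgtP (p F) (p F').
- by case: nd; exists F', v; split=> //; [exact: ltW | left].
- by case: nd'; exists F, v; split=> //; [exact: ltW | left].
Qed.

Lemma card_nondominated (c : nat) : (1 <= n)%N ->
  (forall e, e \in segments n -> cost I e = c) ->
  (nondominated I p #<= `I_n)%card.
Proof.
move=> n_ge1 costE.
(* The default [(0, 0)], taken when no non-dominated point has budget [k * c], can only enlarge the
   image, which merely has to cover all non-dominated points. *)
pose point k :=
  xget (0, 0) [set z | nondominated I p z /\ z.2 = (k * c)%:R]%classic.
apply: (@card_le_trans _ _ _ (point @` `I_n)%classic); last exact: card_image_le.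
apply: subset_card_le => z ndz.
have [F sF z2E] := nondominated_cost ndz.
have {}z2E : z.2 = (#|F| * c)%:R.
  rewrite z2E -sum_nat_const; congr _%:R.
  by apply: eq_bigr => e /(fintype.subsetP sF)/costE.
exists #|F|.
  exact: leq_ltn_trans (subset_leq_card sF) (card_segments_lt n_ge1).
(* The default case is excluded, as [z] itself is a candidate. *)
rewrite /point; case: xgetP => [z' -> [ndz' z'2E]|/(_ z) []//].
by apply: nondominated_inj => //; rewrite z'2E.
Qed.

End Nondominated.

Theorem lemma11 (R : realType) (n : nat) (n_ge1 : (1 <= n)%N)
    (I : instance R n)
    (equal_costs : exists c : nat,
       forall e : {set 'I_n}, e \in segments n -> cost I e = c) :
  (nondominated I (p_linear I) #<= `I_n)%card /\
  (forall L : 'I_n * 'I_n -> R, thresholds I L ->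
     nondominated I (p_minimprov I L) #<= `I_n)%card.
Proof.
have [c costE] := equal_costs.
by split=> [|L _]; apply: card_nondominated costE.
Qed.
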